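(* Let $S,M,N$ be positive integers and let $\delta>0$. (a) Assume $M\ge 4S$ and $N\ge 2\pi MS$. Then $$\mathcal{E}(M,N,S,\delta)\le\frac{2\delta}{C(M,2S)}\,\frac{1}{\sqrt M}\Big(\frac{N}{M}\Big)^{2S-1},$$ where, for integers $M\ge R\geq 2$, $$C(M,R):=\Big(\frac{12-\pi^2}{24}\Big)^{1/2}\Big(\sum_{j=1}^R\ \prod_{k=1,\,k\ne j}^R\frac{1}{(j-k)^2}\Big)^{-1/2}\frac{1}{\sqrt R}\Big(\frac{\pi}{R}\Big)^{R-1}\Big(\frac{M}{R}\Big)^{-(R-1)}\Big\lfloor\frac{M}{R}\Big\rfloor^{R-1}.$$ (b) Assume $M\ge 2S+1$ and $N/M\ge 2\pi\,C(2S)\sqrt{M+1}$, where $$C(\lambda):=2\pi\sum_{j=0}^{\lambda-1}\binom{\lambda-1}{j}\frac{j^\lambda}{\lambda!}.$$ Then $$\mathcal{E}(M,N,S,\delta)\ge\frac{\delta}{4}\binom{4S-2}{2S-1}^{1/2}\frac{1}{\sqrt{M+1}}\Big(\frac{N}{2\pi M}\Big)^{2S-1}.$$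
   Context: Min-max error on the grid. For positive integers $S\le M\le N$ and $\delta>0$, consider complex discrete measures $\mu$ on the grid $\{n/N\}_{n=0}^{N-1}\subset[0,1)$ that are supported in some set $\Omega\subset\{n/N\}_{n=0}^{N-1}$ with $|\Omega|=S$; write $\mu(n/N)\in\mathbb{C}$ for the mass at $n/N$ and $\hat\mu(k)=\sum_{n=0}^{N-1}\mu(n/N)e^{-2\pi i kn/N}$. Let $\mathcal{Y}=\mathcal{Y}(M,N,S,\delta)$ be the set of $y=(y_k)_{k=0}^M\in\mathbb{C}^{M+1}$ for which there is such a $\mu$ with $\big(\sum_{k=0}^M|y_k-\hat\mu(k)|^2\big)^{1/2}\le\delta$. Let $\mathcal{A}$ be the set of all functions $\varphi$ mapping each $y\in\mathcal{Y}$ to a complex discrete measure $\varphi_y$ supported on the grid $\{n/N\}_{n=0}^{N-1}$. Then $$\mathcal{E}(M,N,S,\delta):=\inf_{\varphi\in\mathcal{A}}\ \sup_{(y,\mu)}\Big(\sum_{n=0}^{N-1}\big|\varphi_y(n/N)-\mu(n/N)\big|^2\Big)^{1/2},$$ the supremum being over all pairs $(y,\mu)$ with $y\in\mathcal{Y}$ and $\mu$ a complex discrete measure supported in some set $\Omega\subset\{n/N\}_{n=0}^{N-1}$ with $|\Omega|=S$ and satisfying $\big(\sum_{k=0}^M|y_k-\hat\mu(k)|^2\big)^{1/2}\le\delta$. *)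

(* Defs.v *)
From HB Require Import structures.
From mathcomp Require Import all_boot all_order all_algebra.
From mathcomp Require Import complex.
From mathcomp Require Import all_classical all_reals all_analysis.

Set Implicit Arguments.
Unset Strict Implicit.
Unset Printing Implicit Defensive.

Import Order.TTheory GRing.Theory Num.Theory.

Local Open Scope ring_scope.
Local Open Scope classical_set_scope.

Section Defs.
Variable R : realType.

(* e^{i t} *)
Definition cis (t : R) : R[i] := Complex (cos t) (sin t).

Definition l2norm (I : finType) (v : {ffun I -> R[i]}) : R :=
  Num.sqrt (\sum_i ComplexField.Normc.normc (v i) ^+ 2).

(* A complex discrete measure on the grid {n/N : 0 <= n < N} is given by its
   masses: [mu n] is the mass at the point n/N. *)
Definition grid_measure (N : nat) := {ffun 'I_N -> R[i]}.

Definition gridpt (N : nat) (n : 'I_N) : R := n%:R / N%:R.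

Definition fourier (M N : nat) (mu : grid_measure N) : {ffun 'I_M.+1 -> R[i]} :=
  [ffun k : 'I_M.+1 =>
     \sum_(n < N) mu n * cis (- (2 * pi * k%:R * gridpt n))].

Definition sparse (N S : nat) (mu : grid_measure N) : Prop :=
  exists Omega : {set 'I_N}, #|Omega| = S /\
    forall n, n \notin Omega -> mu n = 0.

Definition consistent (M N S : nat) (delta : R)
    (y : {ffun 'I_M.+1 -> R[i]}) (mu : grid_measure N) : Prop :=
  sparse S mu /\ l2norm (y - fourier M mu) <= delta.

Definition data (M N S : nat) (delta : R) : set {ffun 'I_M.+1 -> R[i]} :=
  [set y | exists mu : grid_measure N, consistent S delta y mu].
Arguments data : clear implicits.

(* The set A of the reconstruction maps, defined on the data set only. *)
Definition recon_map (M N S : nat) (delta : R) : Type :=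
  data M N S delta -> grid_measure N.
Arguments recon_map : clear implicits.

Definition worst_error (M N S : nat) (delta : R)
    (phi : recon_map M N S delta) : \bar R :=
  ereal_sup [set e : \bar R | exists (y : data M N S delta)
      (mu : grid_measure N),
    consistent S delta (val y) mu /\ e = (l2norm (phi y - mu))%:E].

Definition minmax_error (M N S : nat) (delta : R) : \bar R :=
  ereal_inf (range (@worst_error M N S delta)).

(* C(M,Q), for M >= Q >= 2; [%/] is the Euclidean quotient in nat, i.e. the
   floor of M/Q. *)
Definition upper_const (M Q : nat) : R :=
  Num.sqrt ((12 - pi ^+ 2) / 24)
  * (Num.sqrt (\sum_(1 <= j < Q.+1)
       \prod_(1 <= k < Q.+1 | k != j) (1 / (j%:R - k%:R) ^+ 2)))^-1
  * (1 / Num.sqrt Q%:R)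
  * (pi / Q%:R) ^+ (Q - 1)
  * ((M%:R / Q%:R) ^+ (Q - 1))^-1
  * ((M %/ Q)%N%:R) ^+ (Q - 1).

(* C(lambda), for lambda >= 1 *)
Definition lower_const (lambda : nat) : R :=
  2 * pi * \sum_(0 <= j < lambda)
    'C(lambda - 1, j)%:R * (j%:R ^+ lambda / (lambda`!)%:R).

End Defs.

Arguments minmax_error {R} M N S delta.
Arguments upper_const {R} M Q.
Arguments lower_const {R} lambda.

(* Main.v *)
(* Both bounds compare [E] with the least value of |Phi v| / |v| over
   2S-sparse [v], where [Phi] is the Fourier map onto the frequencies 0, .., M.

   Upper bound.  Put [Q = 2S] and [P = M / Q] (floor), and let [v] be supported
   on a set [Om] of [Q] grid points, with nodes [z_m] on the unit circle.  The
   operator [u |-> u (k + q) - z_m ^ q * u k] on sequences kills the contribution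
   of [z_m] and multiplies the one of [z_j] by [z_j ^ q - z_m ^ q].  Applying it
   for every [m != j] with dilations [q <= P] leaves [P + 1] consecutive terms
   that only see the mass at [j], so [|v_j|] is bounded by [|Phi v|] over a
   product of chords [|z_j ^ q - z_m ^ q| / 2].  When [m] is near [j], [q = P]
   gives a chord of about [pi P / N] times the grid distance; otherwise some
   [q <= P] puts [z_j ^ q] and [z_m ^ q] at least a quarter turn apart.  Near
   points on either side contribute factorials; if no point is far from [j], the
   number of points on its right determines [j], which yields
   sum_a 1 / (a! (Q-1-a)!) ^ 2, and each far point gains a factor that pays for
   the remaining indices.

   Lower bound.  The (2S-1)-st finite difference at adjacent grid points has
   Fourier transform [(1 - e^{-it}) ^ (2S-1)], which is small for frequencies
   up to [M].  Its even and odd halves are S-sparse and compatible with common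
   data, so one of them is missed by half their distance. *)

Require Import Defs.
From HB Require Import structures.
From mathcomp Require Import all_boot all_order all_algebra.
From mathcomp Require Import complex.
From mathcomp Require Import all_classical all_reals all_analysis.
From mathcomp Require Import ring lra zify.

Set Implicit Arguments.
Unset Strict Implicit.
Unset Printing Implicit Defensive.

Import Order.TTheory GRing.Theory Num.Theory.
Import numFieldNormedType.Exports.

Local Open Scope ring_scope.

(** * Taylor bounds for the cosine *)

Section Trigonometry.
Variable R : realType.
Implicit Types x t : R.

(** A function with nonnegative derivative increases from its value at 0. Applied repeatedly,
    starting from [cos <= 1], this yields the alternating Taylor bounds below. *)
Lemma ge0_of_derive (f df : R -> R) :
  (forall x, is_derive x (1 : R) f (df x)) -> (forall x, 0 <= x -> 0 <= df x) ->
  f 0 = 0 -> forall x, 0 <= x -> 0 <= f x.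
Proof.
move=> fdf df0 f0 x x0; rewrite -f0.
have cf : continuous f.
  move=> y; apply: differentiable_continuous.
  by apply/derivable1_diffP; exact: ex_derive.
apply: (@ger0_derive1_ndecry R f 0) => //.
- move=> y; rewrite in_itv /= andbT => y0; rewrite derive1E.
  rewrite derive_val; exact/df0/ltW.
- exact: continuous_subspaceT.
Qed.

Lemma sin_le x : 0 <= x -> sin x <= x.
Proof.
move=> x0; rewrite -subr_ge0.
apply: (@ge0_of_derive (fun y => y - sin y) (fun y => 1 - cos y)) => //.
by rewrite sin0 subr0.
Qed.

Lemma cos_ge x : 0 <= x -> 1 - x ^+ 2 / 2 <= cos x.
Proof.
move=> x0; rewrite -subr_ge0.
apply: (@ge0_of_derive (fun y => cos y - (1 - y ^+ 2 / 2)) (fun y => y - sin y)) => //.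
- move=> y; apply: is_derive_eq; rewrite /GRing.scale /=. lra.
- by move=> y y0; rewrite subr_ge0 sin_le.
- by rewrite cos0; lra.
Qed.

Lemma sin_ge x : 0 <= x -> x - x ^+ 3 / 6 <= sin x.
Proof.
move=> x0; rewrite -subr_ge0.
apply: (@ge0_of_derive (fun y => sin y - (y - y ^+ 3 / 6))
  (fun y => cos y - (1 - y ^+ 2 / 2))) => //.
- move=> y; apply: is_derive_eq; rewrite /GRing.scale /=. lra.
- by move=> y y0; rewrite subr_ge0 cos_ge.
- by rewrite sin0; lra.
Qed.

Lemma cos_le x : 0 <= x -> cos x <= 1 - x ^+ 2 / 2 + x ^+ 4 / 24.
Proof.
move=> x0; rewrite -subr_ge0.
apply: (@ge0_of_derive (fun y => 1 - y ^+ 2 / 2 + y ^+ 4 / 24 - cos y)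
  (fun y => sin y - (y - y ^+ 3 / 6))) => //.
- move=> y; apply: is_derive_eq; rewrite /GRing.scale /=. lra.
- by move=> y y0; rewrite subr_ge0 sin_ge.
- by rewrite cos0; lra.
Qed.

(** Otherwise [Num.sqrt 3 <= pi / 2], where the cosine is nonnegative, but its Taylor bound there is
    [1 - 3/2 + 9/24 < 0]. This makes the first factor of [upper_const] positive. *)
Lemma sqr_pi_lt12 : (pi : R) ^+ 2 < 12.
Proof.
rewrite ltNge; apply/negP => pi12.
have p0 := @pi_gt0 R.
set s := Num.sqrt (3 : R).
have s0 : 0 <= s := sqrtr_ge0 _.
have s2 : s ^+ 2 = 3 by rewrite sqr_sqrtr.
have sp : s <= pi / 2 by rewrite -(@ler_pXn2r _ 2) ?nnegrE //; lra.
have : 0 <= cos s by apply: cos_ge0_pihalf; lra.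
have := cos_le s0; have -> : s ^+ 4 = 9 by rewrite (exprM s 2 2) s2; lra.
lra.
Qed.

Lemma ler_cos x t : 0 <= x -> x <= t -> t <= pi -> cos t <= cos x.
Proof.
move=> x0 xt tp; case: (ltgtP x t) xt => // [lt_xt _|-> //].
by apply/ltW; rewrite ltr_cos ?in_itv //=; lra.
Qed.

Lemma cos_le0 x : pi / 2 <= x <= pi -> cos x <= 0.
Proof.
move=> /andP[x1 x2]; rewrite -(@cos_pihalf R).
by apply: ler_cos; have := @pi_gt0 R; lra.
Qed.

Lemma cosD2piMn x (n : nat) : cos (x + 2 * pi * n%:R) = cos x.
Proof.
rewrite -(periodicn (@cosD2pi R) n x); congr (cos (_ + _)).
by rewrite -[in RHS]mulr_natr -[pi *+ 2]mulr_natr; ring.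
Qed.

End Trigonometry.

(** * Squared moduli and annihilation of frequencies *)

Section SquaredModulus.
Variable R : realType.
Implicit Types (a b z w : R[i]) (s t : R).

Definition nsq z : R := ComplexField.Normc.normc z ^+ 2.

Lemma nsqE z : nsq z = complex.Re z ^+ 2 + complex.Im z ^+ 2.
Proof. by case: z => x y; rewrite /nsq /= sqr_sqrtr // addr_ge0 ?sqr_ge0. Qed.

Lemma nsq_ge0 z : 0 <= nsq z.
Proof. exact: sqr_ge0. Qed.

Lemma nsq0 : nsq 0 = 0.
Proof. by rewrite nsqE /= expr0n addr0. Qed.

Lemma nsqM z w : nsq (z * w) = nsq z * nsq w.
Proof. by rewrite /nsq ComplexField.Normc.normcM exprMn. Qed.

Lemma nsq1 : nsq 1 = 1.
Proof. by rewrite nsqE /= expr0n addr0 expr1n. Qed.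

Lemma nsqX z n : nsq (z ^+ n) = nsq z ^+ n.
Proof. by elim: n => [|n IH]; rewrite ?expr0 ?nsq1 // !exprS nsqM IH. Qed.

Lemma nsqN z : nsq (- z) = nsq z.
Proof. by rewrite !nsqE; case: z => x y /=; ring. Qed.

Lemma nsq_prod (I : Type) (r : seq I) (p : pred I) (F : I -> R[i]) :
  nsq (\prod_(i <- r | p i) F i) = \prod_(i <- r | p i) nsq (F i).
Proof. exact: (big_morph _ nsqM nsq1). Qed.

Lemma nsqB_le z w : nsq (z - w) <= 2 * nsq z + 2 * nsq w.
Proof.
rewrite !nsqE; case: z w => x y [u v] /=.
by have := sqr_ge0 (x + u); have := sqr_ge0 (y + v); lra.
Qed.

Lemma cisD s t : cis (s + t) = cis s * cis t.
Proof. by apply/eqP; rewrite eq_complex /= cosD sinD !eqxx /= addrC. Qed.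

Lemma cis0 : cis (0 : R) = 1.
Proof. by rewrite /cis cos0 sin0. Qed.

Lemma cis_exp t n : cis t ^+ n = cis (t * n%:R).
Proof.
elim: n => [|n IH]; first by rewrite mulr0 cis0 expr0.
by rewrite exprS IH -cisD mulrSr addrC mulrDr mulr1.
Qed.

Lemma nsq_cis t : nsq (cis t) = 1.
Proof. by rewrite nsqE /= cos2Dsin2. Qed.

Lemma nsq_cisB s t : nsq (cis s - cis t) = 2 - 2 * cos (s - t).
Proof.
rewrite nsqE /= cosB; have := cos2Dsin2 s; have := cos2Dsin2 t.
by lra.
Qed.

Lemma sqr_l2norm (I : finType) (v : {ffun I -> R[i]}) :
  l2norm v ^+ 2 = \sum_i nsq (v i).
Proof. by rewrite sqr_sqrtr // sumr_ge0 // => i _; apply: sqr_ge0. Qed.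

Lemma l2norm_ge0 (I : finType) (v : {ffun I -> R[i]}) : 0 <= l2norm v.
Proof. exact: sqrtr_ge0. Qed.

Lemma sqr_l2normB_le (I : finType) (v w : {ffun I -> R[i]}) :
  l2norm (v - w) ^+ 2 <= 2 * l2norm v ^+ 2 + 2 * l2norm w ^+ 2.
Proof.
rewrite !sqr_l2norm !mulr_sumr -big_split; apply: ler_sum => i _ /=.
by rewrite !ffunE nsqB_le.
Qed.

End SquaredModulus.

Section Annihilation.
Variables (R : realType) (I : finType) (th : I -> R) (q : I -> nat).

(* The operator [u |-> u (k + q m) - cis (th m * q m) * u k] annihilates the
   frequency [th m], and multiplies squared l2 norms by at most 4. *)
Lemma annihilate_le (s : seq I) (v : I -> R[i]) (L : nat) :
  \sum_(k < L) nsq (\sum_i v i *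
      (\prod_(m <- s) (cis (th i * (q m)%:R) - cis (th m * (q m)%:R))) *
      cis (th i * k%:R)) <=
  4 ^+ size s *
  \sum_(k < L + \sum_(m <- s) q m) nsq (\sum_i v i * cis (th i * k%:R)).
Proof.
elim: s v => [|m s IH] v /=.
  rewrite big_nil addn0 expr0 mul1r; apply: ler_sum => k _.
  by under eq_bigr do rewrite big_nil mulr1.
set d := fun i => cis (th i * (q m)%:R) - cis (th m * (q m)%:R).
have le_step (x y z : R) : x = y -> y <= z -> x <= z by move=> ->.
(* The factor of [m] is absorbed into the masses. *)
apply: le_step (le_trans (IH (fun i => v i * d i)) _).
  apply: eq_bigr => k _; congr nsq; apply: eq_bigr => i _.
  by rewrite big_cons /d; ring.
rewrite exprSr -mulrA ler_wpM2l ?exprn_ge0 //.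
rewrite big_cons [(q m + _)%N]addnC addnA.
set L' := (L + _)%N.
pose U k := \sum_i v i * cis (th i * k%:R).
have stepE k : \sum_i v i * d i * cis (th i * k%:R) =
    U (k + q m)%N - cis (th m * (q m)%:R) * U k.
  rewrite /U mulr_sumr -sumrB; apply: eq_bigr => i _.
  by rewrite [(k + q m)%:R]natrD [th i * (_ + _)]mulrDr cisD /d; ring.
apply: (@le_trans _ _ (\sum_(k < L') (2 * nsq (U (k + q m)%N) + 2 * nsq (U k)))).
  apply: ler_sum => k _; rewrite stepE; apply: le_trans (nsqB_le _ _) _.
  by rewrite nsqM nsq_cis mul1r.
rewrite big_split /= -!mulr_sumr.
(* The shifted and the unshifted window both lie in the window of length [L' + q m], so each costs
   at most twice the full sum. *)
have le1 : \sum_(k < L') nsq (U (k + q m)%N) <= \sum_(k < L' + q m) nsq (U k).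
  rewrite [leRHS](_ : _ = \sum_(k < q m + L') nsq (U k)); last first.
    by rewrite -!(big_mkord xpredT (fun k => nsq (U k))) addnC.
  rewrite [leRHS]big_split_ord /=; under eq_bigr do rewrite addnC.
  by rewrite lerDr sumr_ge0 // => k _; apply: nsq_ge0.
have le2 : \sum_(k < L') nsq (U k) <= \sum_(k < L' + q m) nsq (U k).
  by rewrite [leRHS]big_split_ord /= lerDl sumr_ge0 // => k _; apply: nsq_ge0.
rewrite /U in le1 le2 *; lra.
Qed.

End Annihilation.

(** * Distances on the grid *)

(** The largest of [#|A|] distinct positive integers is at least [#|A|]; remove it and induct.
    Truncation at [Q] is harmless because [#|A| <= Q]. *)
Lemma fact_le_prod_minn (T : finType) (A : {set T}) (o : T -> nat) (Q : nat) :
  {in A &, injective o} -> (forall m, m \in A -> (0 < o m)%N) ->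
  (#|A| <= Q)%N -> ((#|A|)`! <= \prod_(m in A) minn (o m) Q)%N.
Proof.
elim: {A}_.+1 {-2}A (ltnSn #|A|) => // n IH A leAn oinj o_gt0 leAQ.
have [->|[x xA]] := set_0Vmem A; first by rewrite cards0 big_set0.
case: (arg_maxnP o xA) => m mA maxm.
have {}mA : m \in A := mA.
have A_gt0 : (0 < #|A|)%N by apply/card_gt0P; exists x.
have leAo : (#|A| <= o m)%N.
  rewrite cardE -(size_map o) -(size_iota 1 (o m)).
  apply: uniq_leq_size.
    rewrite map_inj_in_uniq ?enum_uniq // => i k; rewrite !mem_enum.
    exact: oinj.
  move=> k /mapP [i iA ->]; rewrite mem_enum in iA.
  rewrite mem_iota o_gt0 //= add1n ltnS.
  exact: maxm.
rewrite (big_setD1 m) //=.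
have cA : #|A| = #|A :\ m|.+1 by rewrite (cardsD1 m A) mA.
rewrite {1}cA factS -cA leq_mul // ?leq_min ?leAo //.
apply: IH => [|i k|i|]; rewrite ?in_setD1.
- by rewrite -cA -ltnS.
- by move=> /andP[_ iA] /andP[_ kA]; exact: oinj.
- by move=> /andP[_]; exact: o_gt0.
- by apply: leq_trans leAQ; rewrite cA.
Qed.

Lemma fact_addn_le (b f n : nat) : (b + f <= n)%N -> ((b + f)`! <= b`! * n ^ f)%N.
Proof.
elim: f => [|f IH]; first by rewrite addn0 muln1.
rewrite addnS => lt_n; rewrite factS expnS mulnCA leq_mul // IH //.
exact: ltnW.
Qed.

Section Offsets.
Variable N : nat.
Implicit Types j k m : 'I_N.

(* The representative of [m - j] modulo [N] in [0, N). *)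
Definition offset j m : nat := if (j <= m)%N then (m - j)%N else (m + N - j)%N.

Lemma offset_gt0 j m : m != j -> (0 < offset j m)%N.
Proof.
move=> /negP neq; rewrite /offset; have := ltn_ord j; have := ltn_ord m.
have : (m <> j :> nat) by move=> e; apply: neq; apply/eqP/val_inj.
case: ifP; lia.
Qed.

Lemma offsetC j m : m != j -> (offset j m + offset m j = N)%N.
Proof.
move=> /negP neq; rewrite /offset; have := ltn_ord j; have := ltn_ord m.
have : (m <> j :> nat) by move=> e; apply: neq; apply/eqP/val_inj.
case: ifP; case: ifP; lia.
Qed.

Lemma offset_injr j : injective (offset j).
Proof.
move=> m k; rewrite /offset => e; apply: val_inj => /=; move: e.
have := ltn_ord j; have := ltn_ord m; have := ltn_ord k.
case: ifP; case: ifP; lia.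
Qed.

Lemma offset_injl j : injective (offset^~ j).
Proof.
move=> m k; rewrite /offset => e; apply: val_inj => /=; move: e.
have := ltn_ord j; have := ltn_ord m; have := ltn_ord k.
case: ifP; case: ifP; lia.
Qed.

Lemma offsetD j k m : (offset j k + offset k m < N)%N ->
  offset j m = (offset j k + offset k m)%N.
Proof.
rewrite /offset; have := ltn_ord j; have := ltn_ord m; have := ltn_ord k.
by case: ifP; case: ifP; case: ifP; lia.
Qed.

End Offsets.

(** * Chords between dilated nodes, near and far *)

Section NearFar.
Variable R : realType.

Definition freq (N : nat) (n : 'I_N) : R := - (2 * pi * (n%:R / N%:R)).

(** Wrapping around the grid changes the angle by [2 * pi * q]. The division by 4 anticipates the
    loss of 4 per annihilated frequency. *)
Lemma nsq_cis_freqB (N q : nat) (j m : 'I_N) :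
  nsq (cis (freq j * q%:R) - cis (freq m * q%:R)) / 4 =
  (1 - cos (2 * pi * (q * offset j m)%:R / N%:R)) / 2.
Proof.
have N0 : (N%:R : R) != 0.
  by rewrite pnatr_eq0 -lt0n (leq_ltn_trans _ (ltn_ord j)).
rewrite nsq_cisB.
suff -> : cos (2 * pi * (q * offset j m)%:R / N%:R) =
          cos (freq j * q%:R - freq m * q%:R) by lra.
rewrite /offset /freq; case: ifP => [jm|/negbT].
  by congr cos; rewrite natrM natrB //; field.
rewrite -ltnNge => mj.
rewrite -[RHS](cosD2piMn _ q); congr cos.
rewrite natrM natrB; last by have := ltn_ord j; lia.
by rewrite natrD; field.
Qed.

Lemma nsq_cis_freqC (N q : nat) (j m : 'I_N) :
  nsq (cis (freq j * q%:R) - cis (freq m * q%:R)) =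
  nsq (cis (freq m * q%:R) - cis (freq j * q%:R)).
Proof. by rewrite -nsqN opprB. Qed.

(** With [y] the half angle for [minn o Q], the Taylor bound gives [(1 - cos (2 * y)) / 2 >= y ^ 2 -
    y ^ 4 / 3]. Truncating at [Q] ensures [y * Q <= 1], hence the relative loss [1 / (3 * Q ^ 2)];
    monotonicity of the cosine on [[0, pi]] returns to [o]. *)
Lemma near_le (N P Q o : nat) : (0 < N)%N -> (0 < Q)%N ->
  pi * P%:R * Q%:R ^+ 2 <= N%:R :> R -> (2 * P * o <= N)%N ->
  (1 - (3 * Q%:R ^+ 2)^-1) * (pi * P%:R / N%:R * (minn o Q)%:R) ^+ 2 <=
  (1 - cos (2 * pi * (P * o)%:R / N%:R)) / 2 :> R.
Proof.
move=> N0 Q0 PQN PoN; set r := minn o Q; set y := pi * P%:R / N%:R * r%:R.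
have p0 := @pi_gt0 R.
have NR : 0 < N%:R :> R by rewrite ltr0n.
have QR : 0 < Q%:R :> R by rewrite ltr0n.
have y0 : 0 <= y by rewrite /y !mulr_ge0 ?invr_ge0 // ltW.
have yQ : y * Q%:R <= 1.
  have -> : y * Q%:R = pi * P%:R * Q%:R * r%:R / N%:R.
    by rewrite /y; field; rewrite gt_eqF.
  rewrite ler_pdivrMr // mul1r; apply: le_trans PQN.
  rewrite expr2 mulrA ler_wpM2l ?ler_nat ?geq_minr // !mulr_ge0 //; exact: ltW.
have y2Q : y ^+ 2 * Q%:R ^+ 2 <= 1.
  by rewrite -exprMn exprn_ile1 // mulr_ge0 // ltW.
have y2 : y ^+ 2 / 3 <= (3 * Q%:R ^+ 2)^-1.
  rewrite -[leRHS]mul1r ler_pdivlMr ?mulr_gt0 ?exprn_gt0 //.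
  by have -> : y ^+ 2 / 3 * (3 * Q%:R ^+ 2) = y ^+ 2 * Q%:R ^+ 2 by field.
have cosy : cos (2 * pi * (P * o)%:R / N%:R) <= cos (2 * y).
  apply: ler_cos.
  - by rewrite mulr_ge0.
  - rewrite /y natrM.
    have -> : 2 * (pi * P%:R / N%:R * r%:R) = 2 * pi * (P%:R * r%:R) / N%:R :> R.
      by field; rewrite gt_eqF.
    rewrite ler_pM2r ?invr_gt0 // ler_pM2l ?mulr_gt0 // ler_wpM2l //.
    by rewrite ler_nat geq_minl.
  - rewrite ler_pdivrMr // -mulrA mulrCA ler_pM2l //.
    by rewrite -natrM ler_nat mulnA.
have y20 : 0 <= 2 * y by rewrite mulr_ge0.
have := cos_le y20.
have -> : (2 * y) ^+ 2 = 4 * y ^+ 2 by ring.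
have -> : (2 * y) ^+ 4 = 16 * (y ^+ 2) ^+ 2 by ring.
have : y ^+ 2 * (y ^+ 2 / 3) <= y ^+ 2 * (3 * Q%:R ^+ 2)^-1.
  by rewrite ler_wpM2l // sqr_ge0.
lra.
Qed.

(** Some multiple of [o] lies in [[N / 4, N / 2]], where the angle is between [pi / 2] and [pi]:
    either [o] itself, or steps shorter than [N / 4] cannot jump over this interval. *)
Lemma far_le (N P o : nat) : (0 < N)%N -> (N < 2 * P * o)%N -> (2 * o <= N)%N ->
  exists2 q, (q <= P)%N & cos (2 * pi * (q * o)%:R / N%:R) <= 0 :> R.
Proof.
move=> N0 NPo oN.
have [q qP /andP[lo hi]] : exists2 q, (q <= P)%N & (N <= 4 * (q * o) <= 2 * N)%N.
  have o0 : (0 < o)%N by case: (o) NPo; lia.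
  have [N4o|N4o] := leqP N (4 * o).
    by exists 1%N; [case: (P) NPo; lia|lia].
  (* This is [N / (4 * o)] rounded up, the least [q] with [N <= 4 * q * o]. *)
  exists ((N.-1 %/ (4 * o)).+1)%N.
    by rewrite ltn_divLR; nia.
  have := divn_eq N.-1 (4 * o); have := @ltn_pmod N.-1 (4 * o).
  set d := (_ %/ _)%N; set e := (_ %% _)%N; nia.
have NR : 0 < N%:R :> R by rewrite ltr0n.
have p0 := @pi_gt0 R.
exists q => //; apply: cos_le0.
have loR : N%:R <= 4 * (q * o)%:R :> R by rewrite -natrM ler_nat.
have hiR : 4 * (q * o)%:R <= 2 * N%:R :> R by rewrite -!natrM ler_nat.
rewrite ler_pdivlMr // ler_pdivrMr //.
have hi_pi := ler_wpM2l (ltW p0) hiR; have lo_pi := ler_wpM2l (ltW p0) loR.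
by apply/andP; split; lra.
Qed.

End NearFar.

(** * The product of chords *)

Lemma sum_inj_le (R : numDomainType) (T : finType) (A : {set T}) (f : T -> nat)
    (Q : nat) (w : nat -> R) :
  (forall i, 0 <= w i) -> {in A &, injective f} ->
  (forall x, x \in A -> (f x < Q)%N) ->
  \sum_(x in A) w (f x) <= \sum_(i < Q) w i.
Proof.
move=> w_ge0 finj ltfQ.
case: Q ltfQ => [ltf0|Q ltfQ].
  by rewrite big_ord0 big1 // => x /ltf0.
have hK x : x \in A -> (inord (f x) : 'I_Q.+1) = f x :> nat.
  by move=> xA; rewrite inordK ?ltfQ.
rewrite (eq_bigr (fun x => w (inord (f x) : 'I_Q.+1))); last first.
  by move=> x xA; rewrite hK.
rewrite -(big_imset (fun i : 'I_Q.+1 => w i)) /=; last first.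
  by move=> x y xA yA /(congr1 val) /=; rewrite !hK //; exact: finj.
by rewrite [leRHS](bigID (mem [set inord (f x) | x in A])) /= lerDl sumr_ge0.
Qed.

Section ProductBound.
Variables (R : realType) (N P Q : nat) (Om : {set 'I_N}).
Hypotheses (N_gt0 : (0 < N)%N) (P_gt1 : (1 < P)%N) (Q_gt1 : (1 < Q)%N).
Hypothesis cardOm : #|Om| = Q.
Hypothesis PQN : pi * P%:R * Q%:R ^+ 2 <= N%:R :> R.
Implicit Types j m : 'I_N.

Definition near_loss : R := 1 - (3 * Q%:R ^+ 2)^-1.
(** To first order, half of [|z_j ^ P - z_m ^ P|] for adjacent grid points. *)
Definition chord : R := pi * P%:R / N%:R.

(** Near means that dilation by [P] keeps the angle within half a turn. *)
Definition near_right j := [set m in Om :\ j | (2 * P * offset j m <= N)%N].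
Definition near_left j := [set m in Om :\ j | (2 * P * offset m j <= N)%N].
Definition far j := Om :\ j :\: near_right j :\: near_left j.

(** A lower bound for a quarter of the squared chord at a suitable dilation; [2^-1] is the value at
    a quarter turn. *)
Definition gap_bound j m : R :=
  if (2 * P * offset j m <= N)%N
  then near_loss * (chord * (minn (offset j m) Q)%:R) ^+ 2
  else if (2 * P * offset m j <= N)%N
  then near_loss * (chord * (minn (offset m j) Q)%:R) ^+ 2
  else 2^-1.

Let Q_gt0 : 0 < Q%:R :> R.
Proof. by rewrite ltr0n ltnW. Qed.

Let chord_gt0 : 0 < chord.
Proof.
by rewrite /chord divr_gt0 ?mulr_gt0 ?pi_gt0 ?ltr0n // ltnW.
Qed.

Let chordQ : chord * Q%:R ^+ 2 <= 1.
Proof.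
have N0 : 0 < N%:R :> R by rewrite ltr0n.
by rewrite /chord mulrAC ler_pdivrMr // mul1r.
Qed.

Let near_loss_gt0 : 0 < near_loss.
Proof.
have : 1 <= Q%:R :> R by rewrite ler1n ltnW.
move=> /(exprn_ege1 2) q2.
by rewrite /near_loss subr_gt0 invf_lt1 ?mulr_gt0 ?exprn_gt0 //; lra.
Qed.

Let near_loss_ge0 : 0 <= near_loss. Proof. exact: ltW. Qed.

Let near_loss_le1 : near_loss <= 1.
Proof. by rewrite /near_loss gerBl invr_ge0 mulr_ge0 ?sqr_ge0. Qed.

Lemma gap_bound_ge0 j m : 0 <= gap_bound j m.
Proof.
rewrite /gap_bound; case: ifP => _; last case: ifP => _; last by rewrite invr_ge0.
  exact: mulr_ge0 near_loss_ge0 (sqr_ge0 _).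
exact: mulr_ge0 near_loss_ge0 (sqr_ge0 _).
Qed.

Lemma exists_dilation j m : m != j -> exists2 q, (q <= P)%N &
  gap_bound j m <= nsq (cis (freq R j * q%:R) - cis (freq R m * q%:R)) / 4.
Proof.
move=> neq; rewrite /gap_bound /near_loss /chord; case: ifP => [nr|/negbT nnr].
  by exists P => //; rewrite nsq_cis_freqB near_le // ltnW.
case: ifP => [nl|/negbT nnl].
  by exists P => //; rewrite nsq_cis_freqC nsq_cis_freqB near_le // ltnW.
rewrite -ltnNge in nnr; rewrite -ltnNge in nnl.
have offC := offsetC neq.
(* The two offsets add up to [N], so one of them is at most [N / 2]. *)
have [le|lt] := leqP (2 * offset j m) N.
  have [q qP c0] := @far_le R _ _ _ N_gt0 nnr le.
  by exists q => //; rewrite nsq_cis_freqB; lra.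
have le : (2 * offset m j <= N)%N by clear - lt offC; lia.
have [q qP c0] := @far_le R _ _ _ N_gt0 nnl le.
by exists q => //; rewrite nsq_cis_freqC nsq_cis_freqB; lra.
Qed.

Lemma prod_near (A : {set 'I_N}) (o : 'I_N -> nat) :
  \prod_(m in A) (near_loss * (chord * (o m)%:R) ^+ 2) =
  near_loss ^+ #|A| * (chord ^+ 2) ^+ #|A| * (\prod_(m in A) o m)%N%:R ^+ 2.
Proof.
rewrite big_split /= prodr_const -mulrA; congr (_ * _).
under eq_bigr do rewrite exprMn.
by rewrite big_split /= prodr_const natr_prod prodrXl.
Qed.

Lemma prod_near_ge (A : {set 'I_N}) (o : 'I_N -> nat) :
  {in A &, injective o} -> (forall m, m \in A -> (0 < o m)%N) ->
  (#|A| <= Q)%N ->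
  near_loss ^+ #|A| * (chord ^+ 2) ^+ #|A| * ((#|A|)`!)%:R ^+ 2 <=
  \prod_(m in A) (near_loss * (chord * (minn (o m) Q)%:R) ^+ 2).
Proof.
move=> oinj o0 AQ; rewrite prod_near ler_wpM2l //.
  by rewrite mulr_ge0 ?exprn_ge0 // ltW.
by rewrite ler_pXn2r ?nnegrE // ler_nat fact_le_prod_minn.
Qed.

Let four_le z : (4 * z <= 2 * P * z)%N.
Proof. by rewrite leq_mul // (@leq_mul 2 2 2 P). Qed.

Lemma near_right_left j m : m \in near_right j -> m \notin near_left j.
Proof.
rewrite !inE => /andP[/andP[neq mOm] nr]; rewrite neq mOm /= -ltnNge.
have := four_le (offset j m); have := four_le (offset m j).
by have := offsetC neq; clear - N_gt0 nr; lia.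
Qed.

Lemma near_right_sub j : near_right j \subset Om :\ j.
Proof. by apply/fintype.subsetP => m; rewrite inE => /andP[]. Qed.

Lemma near_left_sub j : near_left j \subset Om :\ j :\: near_right j.
Proof.
apply/fintype.subsetP => m mL; rewrite finset.in_setD; apply/andP; split.
  by apply/negP => /near_right_left; rewrite mL.
by move: mL; rewrite inE => /andP[].
Qed.

Lemma card_near_far j : j \in Om ->
  (#|near_right j| + #|near_left j| + #|far j| = Q.-1)%N.
Proof.
move=> jOm; have cOmj : #|Om :\ j| = Q.-1 by rewrite -cardOm (cardsD1 j Om) jOm.
by rewrite -cOmj -(cardsID (near_right j) (Om :\ j)) (finset.setIidPr (near_right_sub j))
  -(cardsID (near_left j) (Om :\ j :\: _)) (finset.setIidPr (near_left_sub j)) addnA.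
Qed.

(** On each side the offsets are distinct and positive, so the near points there contribute a
    factorial. *)
Lemma prod_gap_ge j : j \in Om ->
  near_loss ^+ (#|near_right j| + #|near_left j|) *
  (chord ^+ 2) ^+ (#|near_right j| + #|near_left j|) *
  ((#|near_right j|)`! * (#|near_left j|)`!)%:R ^+ 2 * 2^-1 ^+ #|far j| <=
  \prod_(m in Om :\ j) gap_bound j m.
Proof.
move=> jOm.
have cs := card_near_far jOm.
rewrite (big_setID (near_right j)) (finset.setIidPr (near_right_sub j)) /=.
rewrite [X in _ <= _ * X](big_setID (near_left j)) (finset.setIidPr (near_left_sub j)) /=.
have -> : \prod_(m in near_right j) gap_bound j m =
    \prod_(m in near_right j) (near_loss * (chord * (minn (offset j m) Q)%:R) ^+ 2).
  by apply: eq_bigr => m; rewrite inE /gap_bound => /andP[_ ->].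
have -> : \prod_(m in near_left j) gap_bound j m =
    \prod_(m in near_left j) (near_loss * (chord * (minn (offset m j) Q)%:R) ^+ 2).
  apply: eq_bigr => m mL; rewrite /gap_bound ifF; last first.
    apply/negbTE/negP => nr.
    have /near_right_left : m \in near_right j.
      by move: mL; rewrite !inE => /andP[-> _].
    by rewrite mL.
  by move: mL; rewrite inE => /andP[_ ->].
have -> : \prod_(m in far j) gap_bound j m = 2^-1 ^+ #|far j|.
  rewrite -prodr_const; apply: eq_bigr => m; rewrite !inE /gap_bound.
  case/and3P => nl nr mOmj; rewrite mOmj /= in nl nr.
  by rewrite (negbTE nl) (negbTE nr).
rewrite !exprD natrM [leRHS]mulrA ler_wpM2r ?exprn_ge0 //.
have hR : near_loss ^+ #|near_right j| * (chord ^+ 2) ^+ #|near_right j| *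
    ((#|near_right j|)`!)%:R ^+ 2 <=
    \prod_(m in near_right j) (near_loss * (chord * (minn (offset j m) Q)%:R) ^+ 2).
  apply: prod_near_ge; last by clear - cs; lia.
  - by move=> m k _ _; exact: offset_injr.
  - by move=> m; rewrite !inE => /andP[/andP[neq _] _]; exact: offset_gt0.
have hL : near_loss ^+ #|near_left j| * (chord ^+ 2) ^+ #|near_left j| *
    ((#|near_left j|)`!)%:R ^+ 2 <=
    \prod_(m in near_left j) (near_loss * (chord * (minn (offset m j) Q)%:R) ^+ 2).
  apply: prod_near_ge; last by clear - cs; lia.
  - by move=> m k _ _; exact: offset_injl.
  - by move=> m; rewrite !inE eq_sym => /andP[/andP[neq _] _]; exact: offset_gt0.
have pos c (n : nat) : 0 <= near_loss ^+ c * (chord ^+ 2) ^+ c * n%:R ^+ 2.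
  by rewrite !mulr_ge0 ?exprn_ge0 // ltW.
have := ler_pM (pos _ _) (pos _ _) hR hL.
by congr (_ <= _); ring.
Qed.

Lemma prod_gap_gt0 j : j \in Om -> 0 < \prod_(m in Om :\ j) gap_bound j m.
Proof.
move=> jOm; apply: lt_le_trans (prod_gap_ge jOm).
by rewrite !mulr_gt0 ?exprn_gt0 // ltr0n muln_gt0 !fact_gt0.
Qed.

(* Near points are within a quarter turn since [2 <= P], so that clockwise
   distances between them add up without wrapping around. *)
Lemma near_right_anti j k : j \in Om -> k \in Om ->
  far j = finset.set0 -> far k = finset.set0 ->
  k \in near_right j -> (#|near_right k| < #|near_right j|)%N.
Proof.
move=> jOm kOm fj fk kR; apply/proper_card/properP; split; last first.
  by exists k => //; rewrite !inE eqxx.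
apply/fintype.subsetP => m mR; move: (kR) (mR).
rewrite !inE => /andP[/andP[nkj _] okj] /andP[/andP[nmk mOm] omk].
have x0 := offset_gt0 nkj; have y0 := offset_gt0 nmk.
have x4 := leq_trans (four_le _) okj; have y4 := leq_trans (four_le _) omk.
have xyN : (offset j k + offset k m < N)%N.
  by clear - x4 y4 N_gt0; lia.
have oxy := offsetD xyN.
have nmj : m != j.
  apply/negP => /eqP e; move: oxy; rewrite e {1}/offset leqnn subnn; clear - x0; lia.
have : m \notin far j by rewrite fj inE.
rewrite !inE nmj mOm /=; have := offsetC nmj; rewrite oxy => e.
rewrite andbT negb_and !negbK => /orP[mL|//].
(* If [m] were near [j] on the left, three offsets of at most [N / 4] would add up to [N]. *)
by have := leq_trans (four_le _) mL; clear - e x4 y4 N_gt0; lia.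
Qed.

(** Of two points without far points, one has the other on its right, and then its count is strictly
    larger. *)
Lemma card_near_right_inj :
  {in [set j in Om | far j == finset.set0] &, injective (fun j => #|near_right j|)}.
Proof.
move=> j k; rewrite !inE => /andP[jOm /eqP fj] /andP[kOm /eqP fk] /eqP e.
apply/eqP; apply: contraTT e => njk.
have : k \notin far j by rewrite fj inE.
have nkj : k != j by rewrite eq_sym.
rewrite finset.in_setD finset.in_setD in_setD1 nkj kOm /= andbT negb_and !negbK.
case/orP => [kL|kR].
  have jR : j \in near_right k.
    by move: kL; rewrite !inE => /andP[_ ->]; rewrite njk jOm.
  by rewrite /= neq_ltn (near_right_anti kOm jOm fk fj jR).
by rewrite /= neq_ltn (near_right_anti jOm kOm fj fk kR) orbT.
Qed.

(** The product over [k != j] in [upper_const], for [j = i + 1]. *)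
Definition fact_weight (i : nat) : R := (((i`! * (Q.-1 - i)`!)%:R) ^+ 2)^-1.

Lemma fact_weight_ge0 i : 0 <= fact_weight i.
Proof. by rewrite invr_ge0 sqr_ge0. Qed.

(* Replacing [b!] by [(b + f)! / (Q - 1) ^ f] costs at most [(Q - 1) ^ 2] per far
   point, while [chord * Q ^ 2 <= 1] saves [2 * chord ^ 2 <= 2 / Q ^ 4] each. *)
Lemma prod_gap_ge_weight j : j \in Om ->
  near_loss ^+ Q.-1 * (chord ^+ 2) ^+ Q.-1 *
  ((#|near_right j|)`! * (Q.-1 - #|near_right j|)`!)%:R ^+ 2 *
  (if far j == finset.set0 then 1 else Q%:R ^+ 2 / 2) <=
  \prod_(m in Om :\ j) gap_bound j m.
Proof.
move=> jOm; apply: le_trans (prod_gap_ge jOm).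
have := card_near_far jOm; rewrite -cards_eq0.
set a := #|near_right j|; set b := #|near_left j|; set f := #|far j| => abf.
have -> : (Q.-1 - a)%N = (b + f)%N by clear - abf; lia.
have h1 : near_loss ^+ Q.-1 <= near_loss ^+ (a + b).
  by apply: ler_wiXn2l => //; clear - abf; lia.
have h2 : ((a`! * (b + f)`!)%:R : R) ^+ 2 <=
    (a`! * b`!)%:R ^+ 2 * (Q.-1%:R ^+ 2) ^+ f.
  rewrite -exprM [(2 * f)%N]mulnC exprM -exprMn.
  rewrite ler_pXn2r ?nnegrE ?mulr_ge0 ?exprn_ge0 //.
  rewrite -natrX -natrM ler_nat -mulnA leq_mul // fact_addn_le //; clear - abf; lia.
have h3 : (chord ^+ 2) ^+ f * (Q.-1%:R ^+ 2) ^+ f *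
    (if f == 0%N then 1 else Q%:R ^+ 2 / 2) <= 2^-1 ^+ f.
  case: f {abf h2} => [|f] /=; first by rewrite !expr0 !mulr1.
  rewrite -exprMn.
  have kQ : chord ^+ 2 * Q.-1%:R ^+ 2 <= (Q%:R ^+ 2)^-1.
    have k2 : chord <= (Q%:R ^+ 2)^-1.
      by rewrite -[leRHS]mul1r ler_pdivlMr ?exprn_gt0.
    have q1 : Q.-1%:R <= Q%:R :> R by rewrite ler_nat leq_pred.
    apply: (@le_trans _ _ ((Q%:R ^+ 2)^-1 ^+ 2 * Q%:R ^+ 2)).
      apply: ler_pM; rewrite ?sqr_ge0 // ler_pXn2r ?nnegrE ?invr_ge0 ?sqr_ge0 //.
      exact: ltW.
    by rewrite le_eqVlt; apply/orP; left; apply/eqP; field; rewrite gt_eqF.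
  have k0 : 0 <= chord ^+ 2 * Q.-1%:R ^+ 2 by rewrite mulr_ge0 ?sqr_ge0.
  have Q2 : 4 <= Q%:R ^+ 2 :> R.
    by rewrite -natrX ler_nat (@leq_exp2r 2 Q 2).
  have half : chord ^+ 2 * Q.-1%:R ^+ 2 <= 2^-1.
    apply: le_trans kQ _; rewrite lef_pV2 ?posrE ?exprn_gt0 //; lra.
  (* One far point pays for [Q ^ 2 / 2] and still leaves [1 / 2]; each other one costs at most
     [1 / 2]. *)
  rewrite exprSr [2^-1 ^+ _]exprSr -mulrA; apply: ler_pM.
  - by rewrite exprn_ge0.
  - by rewrite mulr_ge0 // mulr_ge0 ?sqr_ge0.
  - by apply: lerXn2r; rewrite ?nnegrE.
  - move: kQ; rewrite -[leRHS]mul1r ler_pdivlMr ?exprn_gt0 //; lra.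
pose c : R := if f == 0%N then 1 else Q%:R ^+ 2 / 2.
rewrite -/c in h3 *.
have c0 : 0 <= c.
  by rewrite /c; case: ifP => _ //; rewrite mulr_ge0 ?sqr_ge0.
have eQ : (chord ^+ 2) ^+ Q.-1 = (chord ^+ 2) ^+ (a + b) * (chord ^+ 2) ^+ f.
  by rewrite -exprD abf.
have kab0 : 0 <= (chord ^+ 2) ^+ (a + b) by rewrite exprn_ge0 ?sqr_ge0.
have kf0 : 0 <= (chord ^+ 2) ^+ f by rewrite exprn_ge0 ?sqr_ge0.
rewrite eQ.
apply: (@le_trans _ _ (near_loss ^+ (a + b) *
    ((chord ^+ 2) ^+ (a + b) * (chord ^+ 2) ^+ f)
    * ((a`! * b`!)%:R ^+ 2 * (Q.-1%:R ^+ 2) ^+ f) * c)).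
  apply: ler_wpM2r => //; apply: ler_pM => //; rewrite ?sqr_ge0 //.
    by rewrite mulr_ge0 ?exprn_ge0 // mulr_ge0.
  by apply: ler_wpM2r => //; rewrite mulr_ge0.
have -> : near_loss ^+ (a + b) * ((chord ^+ 2) ^+ (a + b) * (chord ^+ 2) ^+ f)
    * ((a`! * b`!)%:R ^+ 2 * (Q.-1%:R ^+ 2) ^+ f) * c =
  near_loss ^+ (a + b) * (chord ^+ 2) ^+ (a + b) * (a`! * b`!)%:R ^+ 2 *
    ((chord ^+ 2) ^+ f * (Q.-1%:R ^+ 2) ^+ f * c) by ring.
apply: ler_wpM2l h3; apply: mulr_ge0; last exact: sqr_ge0.
by apply: mulr_ge0 => //; exact: exprn_ge0.
Qed.

(** The indices without far points have distinct weights, summing to at most the full sum [W]. Each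
    of the at most [Q] others costs at most [W * 2 / Q ^ 2], and [Q * 2 / Q ^ 2 <= 1]; hence the
    factor 2. *)
Lemma sum_inv_prod_gap_le :
  \sum_(j in Om) (\prod_(m in Om :\ j) gap_bound j m)^-1 <=
  (near_loss ^+ Q.-1 * (chord ^+ 2) ^+ Q.-1)^-1 * (2 * \sum_(i < Q) fact_weight i).
Proof.
set D := near_loss ^+ Q.-1 * _; set W := \sum_(i < Q) _.
have D0 : 0 < D by rewrite /D mulr_gt0 ?exprn_gt0.
have W0 : 0 <= W by rewrite sumr_ge0 // => i _; exact: fact_weight_ge0.
have ltaQ j : j \in Om -> (#|near_right j| < Q)%N.
  by move/card_near_far; clear - Q_gt1; lia.
pose c j : R := if far j == finset.set0 then 1 else (Q%:R ^+ 2 / 2)^-1.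
have step j : j \in Om -> (\prod_(m in Om :\ j) gap_bound j m)^-1 <=
    D^-1 * (fact_weight #|near_right j| * c j).
  move=> jOm; have := prod_gap_ge_weight jOm; rewrite -/D.
  set X := (if _ then _ else _); have -> : c j = X^-1.
    by rewrite /c /X; case: ifP => // _; rewrite invr1.
  have X0 : 0 < X by rewrite /X; case: ifP => // _; rewrite divr_gt0 ?exprn_gt0.
  have F0 : 0 < ((#|near_right j|)`! * (Q.-1 - #|near_right j|)`!)%:R ^+ 2 :> R.
    by rewrite exprn_gt0 // ltr0n muln_gt0 !fact_gt0.
  move=> h; rewrite /fact_weight -!invfM mulrA.
  have lhs_gt0 := mulr_gt0 (mulr_gt0 D0 F0) X0.
  by rewrite lef_pV2 ?posrE //; exact: lt_le_trans h.
apply: (le_trans (ler_sum _ step)); rewrite -mulr_sumr ler_pM2l ?invr_gt0 //.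
rewrite (bigID (fun j => far j == finset.set0)) /= mulr_natl mulr2n; apply: lerD.
  rewrite (eq_bigr (fun j => fact_weight #|near_right j|)); last first.
    by move=> j /andP[_ e]; rewrite /c e mulr1.
  rewrite (eq_bigl (mem [set j in Om | far j == finset.set0])) /=; last first.
    by move=> j; rewrite !inE.
  apply: (@sum_inj_le _ _ _ (fun j => #|near_right j|)).
  - exact: fact_weight_ge0.
  - exact: card_near_right_inj.
  - by move=> j; rewrite inE => /andP[/ltaQ].
have hW j : j \in Om -> fact_weight #|near_right j| <= W.
  move=> /ltaQ lt; rewrite /W (bigD1 (Ordinal lt)) //= lerDl sumr_ge0 // => i _.
  exact: fact_weight_ge0.
apply: (@le_trans _ _ (\sum_(j in Om) (W * (Q%:R ^+ 2 / 2)^-1))).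
  rewrite [leRHS](bigID (fun j => far j == finset.set0)) /=.
  apply: ler_wpDl.
    by rewrite sumr_ge0 // => j _; rewrite mulr_ge0 // invr_ge0 divr_ge0 ?sqr_ge0.
  apply: ler_sum => j /andP[jOm /negbTE nf]; rewrite /c nf ler_wpM2r ?hW //.
rewrite sumr_const cardOm -[leLHS]mulr_natr -mulrA -[leRHS]mulr1 ler_wpM2l //.
rewrite mulrC ler_pdivrMr ?divr_gt0 ?exprn_gt0 //.
have : 2 <= Q%:R :> R by rewrite ler_nat.
move=> Q2; have := ler_wpM2l (ltW Q_gt0) Q2; lra.
Qed.

End ProductBound.

(** * Lower bound for the Fourier map on sparse measures *)

Section LowerRestrictedIsometry.
Variables (R : realType) (N M Q : nat) (Om : {set 'I_N}).
Hypotheses (N_gt0 : (0 < N)%N) (Q_gt1 : (1 < Q)%N) (M_ge : (2 * Q <= M)%N).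
Hypothesis cardOm : #|Om| = Q.
Hypothesis MQN : pi * M%:R * Q%:R <= N%:R :> R.
Variable v : grid_measure R N.
Hypothesis supp_v : forall n, n \notin Om -> v n = 0.

Let P := (M %/ Q)%N.
Let Q_gt0 : (0 < Q)%N. Proof. exact: ltnW. Qed.
Let P_gt1 : (1 < P)%N. Proof. by rewrite /P leq_divRL. Qed.

Let PQN : pi * P%:R * Q%:R ^+ 2 <= N%:R :> R.
Proof.
apply: le_trans MQN; rewrite expr2 mulrA ler_wpM2r // -mulrA ler_wpM2l ?pi_ge0 //.
by rewrite -natrM ler_nat leq_trunc_div.
Qed.

Lemma sqr_l2norm_fourier :
  l2norm (fourier M v) ^+ 2 =
  \sum_(k < M.+1) nsq (\sum_n v n * cis (freq R n * k%:R)).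
Proof.
rewrite sqr_l2norm; apply: eq_bigr => k _; rewrite ffunE; congr nsq.
by apply: eq_bigr => n _; congr (_ * cis _); rewrite /freq /gridpt; ring.
Qed.

(** Annihilating the other points of [Om] with the dilations of [exists_dilation] leaves [P + 1]
    terms, all of the same modulus. *)
Lemma nsq_mass_le j : j \in Om ->
  P.+1%:R * nsq (v j) <= l2norm (fourier M v) ^+ 2 *
    (\prod_(m in Om :\ j) gap_bound R P Q j m)^-1.
Proof.
move=> jOm; have gap_gt0 := prod_gap_gt0 R N_gt0 P_gt1 Q_gt1 cardOm jOm.
rewrite ler_pdivlMr //.
have /boolp.choice [q qP] : forall m, exists q, m != j -> (q <= P)%N /\
    gap_bound R P Q j m <= nsq (cis (freq R j * q%:R) - cis (freq R m * q%:R)) / 4.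
  (* The dilation 0 at [m = j] is a dummy value. *)
  move=> m; have [->|neq] := eqVneq m j; first by exists 0%N.
  by have [q qP gq] := exists_dilation N_gt0 Q_gt1 PQN neq; exists q.
have cOmj : #|Om :\ j| = Q.-1 by rewrite -cardOm (cardsD1 j Om) jOm.
have := annihilate_le (@freq R N) q (enum (Om :\ j)) v P.+1.
rewrite -cardE cOmj big_enum /=.
set G := \prod_(m in Om :\ j)
  (nsq (cis (freq R j * (q m)%:R) - cis (freq R m * (q m)%:R)) / 4).
have kill (k : nat) : \sum_i v i * (\prod_(m <- enum (Om :\ j))
      (cis (freq R i * (q m)%:R) - cis (freq R m * (q m)%:R))) * cis (freq R i * k%:R) =
    v j * (\prod_(m in Om :\ j)
      (cis (freq R j * (q m)%:R) - cis (freq R m * (q m)%:R))) * cis (freq R j * k%:R).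
  rewrite (bigD1 j) //= [X in _ + X]big1 ?addr0 => [|i neq].
    by congr (_ * _ * _); rewrite big_enum.
  rewrite (_ : \prod_(m <- _) _ = \prod_(m in Om :\ j)
      (cis (freq R i * (q m)%:R) - cis (freq R m * (q m)%:R)));
    last by rewrite big_enum.
  have [iOm|/supp_v ->] := boolP (i \in Om); last by rewrite !mul0r.
  by rewrite (bigD1 i) /= ?subrr ?mul0r ?mulr0 ?mul0r // !inE neq.
under eq_bigr do rewrite kill !nsqM nsq_cis mulr1 nsq_prod.
rewrite sumr_const card_ord => main.
have prodG : \prod_(m in Om :\ j)
    nsq (cis (freq R j * (q m)%:R) - cis (freq R m * (q m)%:R)) = 4 ^+ Q.-1 * G.
  rewrite -cOmj -prodr_const -big_split /=; apply: eq_bigr => m _.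
  by field.
rewrite prodG in main.
have gapG : \prod_(m in Om :\ j) gap_bound R P Q j m <= G.
  apply: ler_prod => m; rewrite !inE => /andP[neq _]; rewrite (qP _ neq).2 andbT.
  exact: gap_bound_ge0.
(* The frequencies used number at most [P + 1 + (Q - 1) * P = P * Q + 1 <= M + 1]. *)
have sumq : (P.+1 + \sum_(m in Om :\ j) q m <= M.+1)%N.
  have : (\sum_(m in Om :\ j) q m <= \sum_(m in Om :\ j) P)%N.
    by apply: leq_sum => m; rewrite !inE => /andP[neq _]; exact: (qP _ neq).1.
  rewrite sum_nat_const cOmj => le.
  have := leq_trunc_div M Q; rewrite -/P => leM.
  have : (P + Q.-1 * P = P * Q)%N by rewrite -mulSn prednK // mulnC.
  by lia.
have le_sum : \sum_(k < P.+1 + \sum_(m in Om :\ j) q m)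
    nsq (\sum_i v i * cis (freq R i * k%:R)) <= l2norm (fourier M v) ^+ 2.
  rewrite sqr_l2norm_fourier -(subnKC sumq) [leRHS]big_split_ord /= lerDl sumr_ge0 //.
  by move=> k _; exact: nsq_ge0.
have e4 : 0 < 4 ^+ Q.-1 :> R by rewrite exprn_gt0.
apply: (@le_trans _ _ (P.+1%:R * nsq (v j) * G)).
  by rewrite ler_wpM2l // mulr_ge0 // nsq_ge0.
apply: le_trans le_sum; rewrite -(ler_pM2l e4); apply: le_trans main.
by rewrite -[leRHS]mulr_natr le_eqVlt; apply/orP; left; apply/eqP; ring.
Qed.

(** By Bernoulli's inequality the total loss is at most [Q / (3 * Q ^ 2) <= 1 / 6]. *)
Lemma near_loss_pow_ge : 5 / 6 <= near_loss R Q ^+ Q.-1.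
Proof.
have Q2 : 2 <= Q%:R :> R by rewrite ler_nat.
pose x : R := (3 * Q%:R ^+ 2)^-1.
have x0 : 0 <= x by rewrite invr_ge0 mulr_ge0 ?sqr_ge0.
have q3 : Q%:R * x <= 1 / 6.
  rewrite /x ler_pdivrMr ?mulr_gt0 ?exprn_gt0 ?ltr0n //.
  by have := ler_wpM2l (ltW (lt_le_trans (@ltr0Sn R 1) Q2)) Q2; lra.
have x1 : x <= 1.
  by have := ler_wpM2r x0 Q2; lra.
have bern k : 1 - k%:R * x <= near_loss R Q ^+ k.
  elim: k => [|k IH]; first by rewrite mul0r subr0 expr0.
  rewrite exprS; apply: le_trans (ler_wpM2l _ IH); rewrite /near_loss -/x ?subr_ge0 //.
  have : 0 <= k%:R * x * x by rewrite !mulr_ge0.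
  by rewrite -natr1; lra.
apply: le_trans (bern Q.-1).
have : Q.-1%:R * x <= Q%:R * x by rewrite ler_wpM2r // ler_nat leq_pred.
lra.
Qed.

(** Sum [nsq_mass_le] over the support. The constant is [12 / 5 = 2 / (5 / 6)], and
    [M <= (P + 1) * Q] accounts for the factor [Q]. *)
Lemma sqr_l2norm_le :
  M%:R * (chord R N P ^+ 2) ^+ Q.-1 * l2norm v ^+ 2 <=
  12 / 5 * Q%:R * (\sum_(i < Q) fact_weight R Q i) * l2norm (fourier M v) ^+ 2.
Proof.
set U := l2norm (fourier M v) ^+ 2; set W := \sum_(i < Q) _.
have U0 : 0 <= U by exact: sqr_ge0.
have W0 : 0 <= W by rewrite sumr_ge0 // => i _; exact: fact_weight_ge0.
have normE : l2norm v ^+ 2 = \sum_(j in Om) nsq (v j).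
  rewrite sqr_l2norm (bigID (mem Om)) /= [X in _ + X]big1 ?addr0 //.
  by move=> j /supp_v ->; rewrite nsq0.
have chord0 : 0 < chord R N P.
  by rewrite /chord divr_gt0 ?mulr_gt0 ?pi_gt0 ?ltr0n // ltnW.
have loss := near_loss_pow_ge.
set D := near_loss R Q ^+ Q.-1 in loss.
set K := (chord R N P ^+ 2) ^+ Q.-1.
have K0 : 0 < K by rewrite !exprn_gt0.
have D0 : 0 < D by lra.
have : P.+1%:R * l2norm v ^+ 2 <= U * ((D * K)^-1 * (2 * W)).
  rewrite normE mulr_sumr.
  apply: le_trans (ler_wpM2l U0
    (sum_inv_prod_gap_le N_gt0 P_gt1 Q_gt1 cardOm PQN)).
  by rewrite mulr_sumr; apply: ler_sum => j; exact: nsq_mass_le.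
have DK0 : 0 < D * K by rewrite mulr_gt0.
move/(ler_wpM2r (ltW DK0)).
rewrite (_ : U * _ * _ = U * (2 * W)); last by field; rewrite !gt_eqF.
move=> main.
have V0 : 0 <= l2norm v ^+ 2 := sqr_ge0 _.
have MP : M%:R <= P.+1%:R * Q%:R :> R.
  by rewrite -natrM ler_nat ltnW // ltn_ceil.
have h1 : P.+1%:R * l2norm v ^+ 2 * K * (5 / 6) <= U * (2 * W).
  apply: le_trans main; rewrite [D * K]mulrC [leRHS]mulrA ler_wpM2l //.
  exact: mulr_ge0 (mulr_ge0 (ler0n _ _) V0) (ltW K0).
have h2 : M%:R * K * l2norm v ^+ 2 <= P.+1%:R * Q%:R * (K * l2norm v ^+ 2).
  by rewrite -mulrA ler_wpM2r // (mulr_ge0 (ltW K0) V0).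
have := ler_wpM2l (ler0n R Q) h1.
by move: h2; lra.
Qed.

End LowerRestrictedIsometry.

(** * The upper bound *)

Lemma exists_superset (T : finType) (A : {set T}) (k : nat) :
  (#|A| <= k <= #|T|)%N -> exists2 B : {set T}, A \subset B & #|B| = k.
Proof.
elim: k => [|k IH] /andP[Ak kT].
  by exists A => //; apply/eqP; rewrite -leqn0.
case: ltngtP Ak => // [Ak|<-] _; last by exists A.
have [|B AB cB] := IH; first by rewrite -ltnS Ak ltnW.
have [x xB] : exists x, x \notin B.
  have /card_gt0P[x] : (0 < #|~: B|)%N by rewrite cardsCs finset.setCK subn_gt0 cB.
  by rewrite finset.in_setC; exists x.
exists (x |: B); last by rewrite cardsU1 xB cB.
by apply: fintype.subset_trans AB _; exact: finset.subsetUr.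
Qed.

Section UpperConstant.
Variable R : realType.

Lemma upper_const_sum (Q : nat) :
  \sum_(1 <= j < Q.+1) \prod_(1 <= k < Q.+1 | k != j)
     (1 / (j%:R - k%:R) ^+ 2 : R) = \sum_(i < Q) fact_weight R Q i.
Proof.
rewrite big_add1 big_mkord /=; apply: eq_bigr => i _.
have prod_low (n : nat) :
    \prod_(0 <= k < n) (1 / (n%:R - k%:R) ^+ 2 : R) = ((n`!)%:R ^+ 2)^-1.
  rewrite big_nat_rev /= add0n fact_prod natr_prod -prodrXl -prodfV.
  rewrite [in RHS]big_add1 /=; apply: eq_big_nat => k /andP[_ kn].
  by rewrite div1r; congr (_ ^+ 2)^-1; rewrite natrB //; ring.
have prod_high (n : nat) :
    \prod_(i.+1 <= k < i.+1 + n) (1 / (i%:R - k%:R) ^+ 2 : R) = ((n`!)%:R ^+ 2)^-1.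
  rewrite -{1}[i.+1]add0n big_addn addKn fact_prod natr_prod -prodrXl -prodfV.
  rewrite [in RHS]big_add1 /=; apply: eq_big_nat => k _.
  rewrite div1r addnS; congr _^-1; rewrite -sqrrN; congr (_ ^+ 2).
  by rewrite -addSn natrD; ring.
rewrite big_add1 /=.
have iQ := ltn_ord i.
rewrite (@big_cat_nat _ _ _ i) //=; last exact: ltnW.
rewrite [X in _ * X]big_ltn_cond // eqxx /=.
rewrite (_ : \prod_(0 <= k < i | _) _ = ((i`!)%:R ^+ 2)^-1); last first.
  rewrite -prod_low; apply: congr_big_nat => //.
    by move=> k /andP[_ ki]; rewrite eqSS ltn_eqF.
  by move=> k _; rewrite -!natr1; congr (1 / _ ^+ 2); ring.
rewrite (_ : \prod_(i.+1 <= k < Q | _) _ = (((Q.-1 - i)`!)%:R ^+ 2)^-1); last first.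
  rewrite -prod_high; apply: congr_big_nat => //.
  - by lia.
  - by move=> k /andP[ik _]; rewrite eqSS gtn_eqF.
  - by move=> k _; rewrite -!natr1; congr (1 / _ ^+ 2); ring.
by rewrite /fact_weight -invfM -exprMn natrM.
Qed.

Lemma fact_weight_sum_gt0 (Q : nat) : (0 < Q)%N -> 0 < \sum_(i < Q) fact_weight R Q i.
Proof.
case: Q => // Q _; rewrite big_ord_recl ltr_wpDr //.
  by rewrite sumr_ge0 // => i _; exact: fact_weight_ge0.
by rewrite invr_gt0 exprn_gt0 // ltr0n muln_gt0 !fact_gt0.
Qed.

(** The [N] in [chord] cancels: both powers have base [pi * (M %/ Q) / M]. *)
Lemma upper_constE (N M Q : nat) : (0 < N)%N -> (0 < M)%N -> (0 < Q)%N ->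
  upper_const M Q =
  Num.sqrt ((12 - pi ^+ 2) / 24) * (Num.sqrt (\sum_(i < Q) fact_weight R Q i))^-1
  * (Num.sqrt Q%:R)^-1 * (chord R N (M %/ Q) * (N%:R / M%:R)) ^+ (Q - 1).
Proof.
move=> N0 M0 Q0; rewrite /upper_const upper_const_sum div1r -!mulrA.
congr (_ * (_ * (_ * _))).
rewrite -exprVn -!exprMn; congr (_ ^+ _).
by rewrite /chord; field; rewrite !pnatr_eq0 -!lt0n N0 M0 Q0.
Qed.

End UpperConstant.

Section UpperBound.
Variables (R : realType) (S M N : nat) (delta : R).
Hypotheses (S_gt0 : (0 < S)%N) (N_gt0 : (0 < N)%N) (delta_gt0 : 0 < delta).
Hypotheses (M_ge : (4 * S <= M)%N) (N_ge : 2 * pi * M%:R * S%:R <= N%:R :> R).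

Definition recovery_bound : R :=
  2 * delta / upper_const M (2 * S) * (1 / Num.sqrt M%:R)
  * (N%:R / M%:R) ^+ (2 * S - 1).

Lemma consistent_fourierB_le (y : {ffun 'I_M.+1 -> R[i]}) (mu nu : grid_measure R N) :
  consistent S delta y mu -> consistent S delta y nu ->
  l2norm (fourier M (mu - nu)) ^+ 2 <= 4 * delta ^+ 2.
Proof.
move=> [_ mu_y] [_ nu_y].
have -> : fourier M (mu - nu) = (y - fourier M nu) - (y - fourier M mu).
  apply/ffunP => k; rewrite !ffunE.
  rewrite (_ : forall a b c : R[i], a - b - (a - c) = c - b); last by move=> *; ring.
  rewrite -sumrB.
  by apply: eq_bigr => n _; rewrite !ffunE mulrBl.
have sq z : l2norm z <= delta -> l2norm z ^+ 2 <= delta ^+ 2.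
  by move=> zd; rewrite ler_pXn2r ?nnegrE ?l2norm_ge0 // ltW.
by apply: le_trans (sqr_l2normB_le _ _) _; move: (sq _ _ mu_y) (sq _ _ nu_y); lra.
Qed.

Lemma consistentB_le (y : {ffun 'I_M.+1 -> R[i]}) (mu nu : grid_measure R N) :
  consistent S delta y mu -> consistent S delta y nu ->
  l2norm (mu - nu) <= recovery_bound.
Proof.
pose Q := (2 * S)%N.
move=> mu_y nu_y.
have fourier_le := consistent_fourierB_le mu_y nu_y.
have Q_gt1 : (1 < Q)%N by rewrite /Q; lia.
have M_gt0 : (0 < M)%N by lia.
have QN : (Q <= N)%N.
  rewrite -(ler_nat R); apply: le_trans N_ge.
  have -> : 2 * pi * M%:R * S%:R = pi * M%:R * Q%:R :> R by rewrite /Q natrM; ring.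
  have M1 : 1 <= M%:R :> R by rewrite ler1n.
  have pM1 := ler_wpM2l (@pi_ge0 R) M1.
  by rewrite ler_peMl //; have := @pi_ge2 R; lra.
have [Om cOm supp] : exists2 Om : {set 'I_N}, #|Om| = Q &
    forall n, n \notin Om -> (mu - nu) n = 0.
  have [[A [cA muA]] _] := mu_y; have [[B [cB nuB]] _] := nu_y.
  (* The two supports may overlap; their union is padded to exactly [Q] points. *)
  have [|Om sOm cOm] := @exists_superset _ (A :|: B) Q.
    rewrite card_ord QN andbT (leq_trans (leq_card_setU _ _)) // cA cB /Q; lia.
  exists Om => // n nOm; have := contra (fintype.subsetP sOm n) nOm.
  rewrite finset.in_setU negb_or => /andP[nA nB].
  by rewrite !ffunE muA // nuB // subr0.
have MQN : pi * M%:R * Q%:R <= N%:R :> R.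
  by apply: le_trans N_ge; rewrite le_eqVlt /Q natrM; apply/orP; left; apply/eqP; ring.
have MQ2 : (2 * Q <= M)%N by rewrite /Q; lia.
have main := sqr_l2norm_le N_gt0 Q_gt1 MQ2 cOm MQN supp.
set W := \sum_(i < Q) _ in main; set c := chord _ _ _ in main.
have W0 : 0 < W by rewrite fact_weight_sum_gt0 // ltnW.
have c0 : 0 < c.
  by rewrite /c /chord divr_gt0 ?mulr_gt0 ?pi_gt0 ?ltr0n // divn_gt0; lia.
have NR : 0 < N%:R :> R by rewrite ltr0n.
have MR : 0 < M%:R :> R by rewrite ltr0n.
have QR : 0 < Q%:R :> R by rewrite ltr0n ltnW.
pose X : R := (12 - pi ^+ 2) / 24.
have X0 : 0 < X by rewrite /X; have := sqr_pi_lt12 R; lra.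
(* From [2 <= pi]. Then [1/3 * 12/5 * 4 = 16/5] stays below the 4 in the squared bound. *)
have X3 : X <= 1 / 3.
  have := ler_pM (@ler0n R 2) (@ler0n R 2) (@pi_ge2 R) (@pi_ge2 R).
  by rewrite /X expr2; lra.
have sW : 0 < Num.sqrt W by rewrite sqrtr_gt0.
have sX : 0 < Num.sqrt X by rewrite sqrtr_gt0.
have sM : 0 < Num.sqrt (M%:R : R) by rewrite sqrtr_gt0.
have sQ : 0 < Num.sqrt (Q%:R : R) by rewrite sqrtr_gt0.
have NM0 : 0 < N%:R / M%:R :> R by rewrite divr_gt0.
have boundE : recovery_bound = 2 * delta * Num.sqrt W * Num.sqrt Q%:R /
    (Num.sqrt X * Num.sqrt M%:R * c ^+ (Q - 1)).
  rewrite /recovery_bound -/Q (@upper_constE _ N) ?(ltnW Q_gt1) // -/W -/X -/c exprMn.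
  by field; rewrite ?expf_neq0 ?gt_eqF //.
clearbody c.
have K0 : 0 < c ^+ (Q - 1) by rewrite exprn_gt0.
have bound_ge0 : 0 <= recovery_bound.
  by rewrite boundE divr_ge0 // !mulr_ge0 // ltW.
rewrite -(@ler_pXn2r _ 2) ?nnegrE ?l2norm_ge0 // boundE expr_div_n.
rewrite ler_pdivlMr ?exprn_gt0 ?mulr_gt0 //.
rewrite !exprMn (sqr_sqrtr (ltW W0)) (sqr_sqrtr (ltW QR)) (sqr_sqrtr (ltW X0))
  (sqr_sqrtr (ltW MR)).
move: main; rewrite exprAC -subn1; set K := (c ^+ (Q - 1)) ^+ 2 => main.
have V0 : 0 <= M%:R * K * l2norm (mu - nu) ^+ 2.
  by apply: mulr_ge0 (sqr_ge0 _); apply: mulr_ge0 => //; exact: sqr_ge0.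
apply: (@le_trans _ _ (1 / 3 * (M%:R * K * l2norm (mu - nu) ^+ 2))).
  rewrite (_ : l2norm _ ^+ 2 * _ = X * (M%:R * K * l2norm (mu - nu) ^+ 2));
    last by ring.
  exact: ler_wpM2r.
have QW0 : 0 <= Q%:R * W by rewrite mulr_ge0 // ltW.
have := ler_wpM2l QW0 fourier_le.
have d0 : 0 <= Q%:R * W * delta ^+ 2 by rewrite mulr_ge0 // sqr_ge0.
by move: main; lra.
Qed.

(** It suffices to reconstruct by any choice of a consistent measure, since all measures consistent
    with the same data are this close. *)
Lemma minmax_error_le : (@minmax_error R M N S delta <= recovery_bound%:E)%E.
Proof.
have recon (y : @data R M N S delta) : exists mu : grid_measure R N,
  consistent S delta (val y) mu by exact: set_valP y.
have [phi phiP] := boolp.choice recon.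
rewrite /minmax_error; apply: ge_ereal_inf.
exists (worst_error (phi : @recon_map R M N S delta)); first by exists phi.
apply: ge_ereal_sup => _ [y [mu [mu_y ->]]]; rewrite lee_fin.
exact: consistentB_le (phiP y) mu_y.
Qed.

End UpperBound.

(** * The lower bound *)

Section LowerBound.
Variables (R : realType) (S M N : nat) (delta : R).
Hypotheses (S_gt0 : (0 < S)%N) (M_gt0 : (0 < M)%N) (SN : (2 * S <= N)%N).
Hypothesis delta_gt0 : 0 < delta.

Lemma fourierB (mu nu : grid_measure R N) :
  fourier M (mu - nu) = fourier M mu - fourier M nu.
Proof.
apply/ffunP => k; rewrite !ffunE -sumrB; apply: eq_bigr => n _.
by rewrite !ffunE mulrBl.
Qed.

Lemma l2normN (I : finType) (v : {ffun I -> R[i]}) : l2norm (- v) = l2norm v.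
Proof.
congr Num.sqrt; apply: eq_bigr => i _.
by rewrite ffunE; exact: (nsqN (v i)).
Qed.

(** Each parity class below [2 * S] has exactly [S] elements, [i.*2 + b] for [i < S]. *)
Lemma sparse_parity (b : bool) (mu : grid_measure R N) :
  (forall m, mu m != 0 -> (m < 2 * S)%N && (odd m == b)) -> sparse S mu.
Proof.
move=> supp.
have ltN (i : 'I_S) : (i.*2 + b < N)%N.
  apply: leq_trans SN; have := ltn_ord i; case: b {supp} => /=; lia.
pose f i := Ordinal (ltN i).
exists [set f i | i in [set: 'I_S]]; split.
  rewrite card_imset ?cardsT ?card_ord // => i j /(congr1 val) /= e.
  by apply: val_inj => /=; move: e; case: b {supp ltN f} => /=; lia.
move=> m; apply: contraNeq => /supp /andP[lt /eqP ob].
have lt2 : (m./2 < S)%N by rewrite ltn_half_double -mul2n.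
apply/imsetP; exists (Ordinal lt2); first by rewrite finset.in_setT.
by apply: val_inj => /=; rewrite -ob addnC odd_double_half.
Qed.

(* The iterated finite difference of order [2 * S - 1]: its Fourier transform
   is [(1 - cis t) ^+ (2 * S - 1)], which is small at low frequencies. *)
Definition diff_measure (c : R) : grid_measure R N :=
  [ffun m : 'I_N => Complex c 0 * ((-1) ^+ m * 'C(2 * S - 1, m)%:R)].

Lemma sum_grid_bin (V : nmodType) (F : nat -> V) :
  (forall m, (2 * S - 1 < m)%N -> F m = 0) ->
  \sum_(m < N) F m = \sum_(m < (2 * S - 1).+1) F m.
Proof.
move=> F0; rewrite -!(big_mkord xpredT) (@big_cat_nat _ _ _ (2 * S - 1).+1) //=.
  rewrite [X in _ + X]big_nat_cond [X in _ + X]big1 ?addr0 // => m /andP[/andP[lt _] _].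
  exact: F0.
by clear - S_gt0 SN; lia.
Qed.

Lemma fourier_diff_measure c k :
  fourier M (diff_measure c) k =
  Complex c 0 * (1 - cis (- (2 * pi * k%:R / N%:R))) ^+ (2 * S - 1).
Proof.
rewrite ffunE; set w := cis _.
pose F m : R[i] := Complex c 0 * ((-1) ^+ m * 'C(2 * S - 1, m)%:R) * w ^+ m.
rewrite (eq_bigr (fun m : 'I_N => F m)); last first.
  move=> m _; rewrite ffunE /F cis_exp; congr (_ * cis _).
  by rewrite /gridpt; ring.
rewrite sum_grid_bin /F => [|m lt]; last by rewrite bin_small // !mulr0 mul0r.
rewrite exprBn mulr_sumr; apply: eq_bigr => m _.
by rewrite expr1n mulr1 -[X in _ = _ * X]mulr_natr; ring.
Qed.

Lemma nsq_real (c : R) : nsq (Complex c 0) = c ^+ 2.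
Proof. by rewrite nsqE /= expr0n addr0. Qed.

Lemma nsq_natr (n : nat) : nsq (n%:R : R[i]) = n%:R ^+ 2 :> R.
Proof. by rewrite -nsq_real; congr nsq; rewrite -(rmorph_nat (real_complex R)). Qed.

(** Vandermonde's identity sums the squared binomials to the central one. *)
Lemma sqr_l2norm_diff_measure c :
  l2norm (diff_measure c) ^+ 2 = c ^+ 2 * 'C(4 * S - 2, 2 * S - 1)%:R.
Proof.
rewrite sqr_l2norm.
pose F m : R := c ^+ 2 * 'C(2 * S - 1, m)%:R ^+ 2.
rewrite (eq_bigr (fun m : 'I_N => F m)); last first.
  by move=> m _; rewrite ffunE !nsqM nsqX nsqN nsq1 expr1n mul1r nsq_real nsq_natr.
rewrite sum_grid_bin /F => [|m lt]; last by rewrite bin_small // expr0n mulr0.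
have -> : (4 * S - 2 = (2 * S - 1) + (2 * S - 1))%N by clear; lia.
rewrite -mulr_sumr -binomial.Vandermonde natr_sum; congr (_ * _); apply: eq_bigr => m _.
have -> : 'C(2 * S - 1, 2 * S - 1 - m) = 'C(2 * S - 1, m).
  by rewrite bin_sub // -ltnS.
by rewrite natrM expr2.
Qed.

(** Each term follows from [|1 - cis t| ^ 2 = 2 - 2 * cos t <= t ^ 2] with
    [|t| <= 2 * pi * M / N]. *)
Lemma sqr_l2norm_fourier_diff_measure_le c :
  l2norm (fourier M (diff_measure c)) ^+ 2 <=
  c ^+ 2 * (M.+1%:R * ((2 * pi * M%:R / N%:R) ^+ (2 * S - 1)) ^+ 2).
Proof.
set g := (_ ^+ _) ^+ 2.
have -> : c ^+ 2 * (M.+1%:R * g) = \sum_(k < M.+1) c ^+ 2 * g.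
  by rewrite sumr_const card_ord -[RHS]mulr_natr; ring.
rewrite sqr_l2norm /g; apply: ler_sum => k _.
rewrite fourier_diff_measure nsqM nsq_real.
rewrite ler_wpM2l ?sqr_ge0 // nsqX [leRHS]exprAC.
apply: lerXn2r; rewrite ?nnegrE ?nsq_ge0 ?sqr_ge0 //.
have p0 := @pi_ge0 R.
have t0 : 0 <= 2 * pi * k%:R / N%:R :> R by rewrite divr_ge0 // !mulr_ge0.
have tM : 2 * pi * k%:R / N%:R <= 2 * pi * M%:R / N%:R :> R.
  rewrite ler_wpM2r ?invr_ge0 // ler_wpM2l ?mulr_ge0 //.
  by rewrite ler_nat -ltnS.
rewrite -{1}cis0 nsq_cisB opprK add0r.
have := cos_ge t0; have := ler_pM t0 t0 tM tM; rewrite -!expr2; lra.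
Qed.

(** Doubling and signs are such that [even_part w - w = odd_part w + w]: the two measures differ
    from a common midpoint by [w] and [- w]. *)
Definition even_part (w : grid_measure R N) : grid_measure R N :=
  [ffun m : 'I_N => if odd m then 0 else w m + w m].
Definition odd_part (w : grid_measure R N) : grid_measure R N :=
  [ffun m : 'I_N => if odd m then - (w m + w m) else 0].

Lemma even_oddB w : even_part w - odd_part w = w + w.
Proof.
by apply/ffunP => m; rewrite !ffunE; case: ifP => _; rewrite ?sub0r ?opprK ?subr0.
Qed.

Lemma diff_measure_neq0 c m : diff_measure c m != 0 -> (m < 2 * S)%N.
Proof.
rewrite ffunE ltnNge; apply: contraNN => le; rewrite bin_small ?mulr0 //.
by clear - S_gt0 le; lia.
Qed.

(** The transform of the midpoint is within [delta] of both parts, which are [2 * w] apart. So any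
    reconstruction from it misses one of them by at least the norm of [w]. *)
Lemma minmax_error_ge c :
  l2norm (fourier M (diff_measure c)) <= delta ->
  ((l2norm (diff_measure c))%:E <= @minmax_error R M N S delta)%E.
Proof.
set w := diff_measure c => Fw.
pose y := fourier M (even_part w) - fourier M w.
have even_y : consistent S delta y (even_part w).
  split.
    apply: (@sparse_parity false) => m; rewrite ffunE.
    case: ifP; rewrite ?eqxx // => om.
    by rewrite andbT => n0; apply: (@diff_measure_neq0 c);
       apply: contraNneq n0; rewrite -/w => ->; rewrite addr0.
  by rewrite /y addrAC subrr sub0r l2normN.
have odd_y : consistent S delta y (odd_part w).
  split.
    apply: (@sparse_parity true) => m; rewrite ffunE.
    case: ifP; rewrite ?eqxx // => om.
    by rewrite andbT => n0; apply: (@diff_measure_neq0 c);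
       apply: contraNneq n0; rewrite -/w => ->; rewrite addr0 oppr0.
  rewrite /y addrAC -fourierB even_oddB -fourierB.
  by rewrite addrK.
apply: le_ereal_inf_tmp => _ [phi _ <-].
have y_data : y \in @data R M N S delta.
  by apply: mem_set; exists (even_part w).
pose y' : @data R M N S delta := exist _ y y_data.
set a := l2norm (phi y' - even_part w); set b := l2norm (phi y' - odd_part w).
have ha : (a%:E <= worst_error phi)%E.
  by apply: ereal_sup_ubound; exists y', (even_part w).
have hb : (b%:E <= worst_error phi)%E.
  by apply: ereal_sup_ubound; exists y', (odd_part w).
have : l2norm (w + w) ^+ 2 <= 2 * b ^+ 2 + 2 * a ^+ 2.
  rewrite -even_oddB; apply: le_trans (sqr_l2normB_le _ _).
  by rewrite opprB [X in _ <= l2norm X ^+ 2]addrC addrA subrK.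
have -> : l2norm (w + w) ^+ 2 = 4 * l2norm w ^+ 2.
  rewrite !sqr_l2norm mulr_sumr; apply: eq_bigr => m _.
  by rewrite !nsqE ffunE; case: (w m) => p q /=; ring.
move=> main.
have [wa|aw] := leP (l2norm w) a; first by apply: le_trans ha; rewrite lee_fin.
apply: le_trans hb; rewrite lee_fin -(@ler_pXn2r _ 2) ?nnegrE ?l2norm_ge0 //.
have : a ^+ 2 <= l2norm w ^+ 2.
  by rewrite ler_pXn2r ?nnegrE ?l2norm_ge0 // ltW.
lra.
Qed.

Lemma minmax_error_ge_bin :
  ((delta * Num.sqrt 'C(4 * S - 2, 2 * S - 1)%:R * (1 / Num.sqrt M.+1%:R)
     * (N%:R / (2 * pi * M%:R)) ^+ (2 * S - 1))%:E
   <= @minmax_error R M N S delta)%E.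
Proof.
have N_gt0 : (0 < N)%N by clear - S_gt0 SN; lia.
pose g : R := 2 * pi * M%:R / N%:R.
have g0 : 0 < g by rewrite /g divr_gt0 ?mulr_gt0 ?pi_gt0 ?ltr0n.
have s0 : 0 < Num.sqrt (M.+1%:R : R) by rewrite sqrtr_gt0.
(* This scaling makes the bound on the transform equal to [delta]. *)
pose c := delta / (Num.sqrt M.+1%:R * g ^+ (2 * S - 1)).
have c0 : 0 <= c by rewrite divr_ge0 ?mulr_ge0 ?exprn_ge0 // ltW.
have Fc : l2norm (fourier M (diff_measure c)) <= delta.
  rewrite -(@ler_pXn2r _ 2) ?nnegrE ?l2norm_ge0 ?(ltW delta_gt0) //.
  apply: le_trans (sqr_l2norm_fourier_diff_measure_le c) _.
  rewrite -/g -[M.+1%:R]sqr_sqrtr // -!exprMn /c divfK //.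
  by rewrite mulf_neq0 ?expf_neq0 ?gt_eqF.
apply: le_trans (minmax_error_ge Fc); rewrite lee_fin.
rewrite le_eqVlt; apply/orP; left; apply/eqP.
have -> : l2norm (diff_measure c) = c * Num.sqrt 'C(4 * S - 2, 2 * S - 1)%:R.
  apply/eqP; rewrite -(@eqrXn2 _ 2) ?l2norm_ge0 ?(mulr_ge0 c0 (sqrtr_ge0 _)) //.
  by rewrite sqr_l2norm_diff_measure [X in _ == X]exprMn sqr_sqrtr.
have -> : N%:R / (2 * pi * M%:R) = g^-1 :> R by rewrite /g invf_div.
by rewrite /c exprVn; field; rewrite expf_neq0 ?gt_eqF.
Qed.

End LowerBound.

(** The last summand, [j = n], is already at least [1 / 2], since [(n + 1)! <= 2 * n * n ^ n]. *)
Lemma lower_const_ge (R : realType) (n : nat) : (0 < n)%N ->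
  pi <= lower_const n.+1 :> R.
Proof.
move=> n0; have p0 := @pi_gt0 R.
rewrite /lower_const big_nat_recr //= subn1 /= binn mul1r.
have fact_le : (n.+1`! <= 2 * n ^ n.+1)%N.
  have := @fact_addn_le 0 n n (leqnn _); rewrite add0n fact0 mul1n => le.
  rewrite factS expnS mulnA leq_mul //; clear - n0; lia.
have half : 1 / 2 <= n%:R ^+ n.+1 / (n.+1`!)%:R :> R.
  rewrite ler_pdivlMr ?ltr0n ?fact_gt0 //.
  move: fact_le; rewrite -(ler_nat R) natrM natrX.
  lra.
set s := \sum_(0 <= j < n) _.
have s0 : 0 <= s.
  by rewrite /s sumr_ge0 // => j _; rewrite mulr_ge0 // divr_ge0 // exprn_ge0.
set x := n%:R ^+ _ / _ in half *.
have := ler_wpM2l (ltW p0) half; have := mulr_ge0 (ltW p0) s0; lra.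
Qed.

Theorem theorem3p8 (R : realType) (S M N : nat) (delta : R)
    (S_gt0 : (0 < S)%N) (M_gt0 : (0 < M)%N) (N_gt0 : (0 < N)%N)
    (delta_gt0 : 0 < delta) :
  ((4 * S <= M)%N ->
   2 * pi * M%:R * S%:R <= N%:R :> R ->
   (minmax_error M N S delta <=
     (2 * delta / upper_const M (2 * S)
      * (1 / Num.sqrt M%:R)
      * (N%:R / M%:R) ^+ (2 * S - 1))%:E)%E)
  /\
  ((2 * S + 1 <= M)%N ->
   2 * pi * lower_const (2 * S) * Num.sqrt (M.+1)%:R <= N%:R / M%:R :> R ->
   ((delta / 4
      * Num.sqrt ('C(4 * S - 2, 2 * S - 1))%:R
      * (1 / Num.sqrt (M.+1)%:R)
      * (N%:R / (2 * pi * M%:R)) ^+ (2 * S - 1))%:E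
     <= minmax_error M N S delta)%E).
Proof.
split=> [M_ge N_ge|M_ge N_ge]; first exact: minmax_error_le.
have p2 := @pi_ge2 R.
have MR : 0 < M%:R :> R by rewrite ltr0n.
(* The hypothesis forces [N / M >= 1], so [N >= M > 2 * S] and both parities fit on the grid. *)
have SN : (2 * S <= N)%N.
  have := @lower_const_ge R (2 * S - 1); rewrite -subSn ?subn1 /=; last first.
    by clear - S_gt0; lia.
  move=> /(_ _)/(le_trans p2) lc.
  have {}lc : 2 <= lower_const (2 * S) :> R by apply: lc; clear - S_gt0; lia.
  have s1 : 1 <= Num.sqrt (M.+1%:R : R) by rewrite -[leLHS]sqrtr1 ler_sqrt // ler1n.
  have : 1 * 1 <= N%:R / M%:R :> R.
    apply: le_trans N_ge; apply: ler_pM => //.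
    have := ler_pM (@ler0n R 2) (@ler0n R 2) p2 lc; lra.
  rewrite mulr1 ler_pdivlMr // mul1r ler_nat; clear - M_ge; lia.
apply: le_trans (minmax_error_ge_bin S_gt0 M_gt0 SN delta_gt0).
rewrite lee_fin -!mulrA ler_wpM2l ?(ltW delta_gt0) //.
(* The bound just applied is four times the claimed one. *)
rewrite ler_piMl ?invf_le1 //; last by lra.
rewrite !mulr_ge0 ?sqrtr_ge0 ?invr_ge0 ?sqrtr_ge0 ?exprn_ge0 //.
by rewrite !mulr_ge0 ?invr_ge0 // !mulr_ge0; lra.
Qed.
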